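(* Let $r \ge 2$ be an integer radix, let $A, M \in \mathbb{R}^{m\times m}$ with $M$ invertible, let $b \in \mathbb{R}^m$, and consider the stationary iterative method for the linear system $Ax=b$, $$x^{(k+1)} = T(x^{(k)}) := (I - M^{-1}A)\,x^{(k)} + M^{-1} b, \qquad k \ge 0,$$ started at some $x^{(0)} \in \mathbb{R}^m$. If $$\|I - M^{-1}A\|_{\infty} < 1,$$ then the method has digit stability in the symmetric maximally redundant number representation of radix $r$: given a number of digits $D \ge 1$, there exist an index $\hat{k} \ge 0$ and a representation of the iterate sequence (a choice of a symmetric maximally redundant radix-$r$ representation of each iterate) such that $$x^{(k)}_{i} = x^{(\hat{k})}_{i} \qquad \text{for all } i \in \{1,\dots,D\} \text{ and all } k > \hat{k}.$$
   Context: Norm: $\|\cdot\|_\infty$ on matrices is the operator norm induced by the infinity norm on $\mathbb{R}^m$. Symmetric maximally redundant representation of radix $r$: the signed-digit representation with digit set $\{-(r-1),\dots,-1,0,1,\dots,r-1\}$. A real number $v$ is represented by a (finite or infinite) digit string $(v_i)_{i \ge -p}$, for some integer $p\ge 0$, with $v = \sum_{i \ge -p} v_i r^{-i}$; thus the digit with index $i$ has weight $r^{-i}$. Representations are not unique. Digits are indexed so that appending further digits after the digit with index $D$ changes the value by an amount in the interval $(-r^{-D}, r^{-D})$ (for finitely many appended digits). Vectors are represented componentwise, and $x^{(k)}_i$ denotes the $i$-th digit (digit vector, one digit per component) of the chosen representation of $x^{(k)}$. The $D$ most-significant digits are those with indices $1,\dots,D$; any digits to the left of the radix point (indices $\le 0$)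 count as leading digits and are understood to be unchanged as well. *)

(* Defs.v *)
From mathcomp Require Import all_boot all_order all_algebra.
From mathcomp Require Import all_classical all_reals all_analysis.
Set Implicit Arguments.
Unset Strict Implicit.
Unset Printing Implicit Defensive.
Import Order.TTheory GRing.Theory Num.Theory numFieldNormedType.Exports.
Local Open Scope classical_set_scope.
Local Open Scope ring_scope.

(* The library norm `|v| of v : 'cV[R]_m is max_i `|v i 0|, the infinity norm. *)
Definition opnorm_oo (R : realType) (m : nat) (B : 'M[R]_m) : R :=
  sup [set `|B *m v| | v in [set v : 'cV[R]_m | `|v| <= 1]].

Definition stationary_map (R : realType) (m : nat) (A M : 'M[R]_m)
    (b x : 'cV[R]_m) : 'cV[R]_m :=
  (1%:M - invmx M *m A) *m x + invmx M *m b.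

Definition stationary_iterate (R : realType) (m : nat) (A M : 'M[R]_m)
    (b x0 : 'cV[R]_m) (k : nat) : 'cV[R]_m :=
  iter k (stationary_map A M b) x0.

(* A digit string is a function of the (signed) digit index, the digit of      *)
(* index i having weight r^(-i).  A string (d_i)_{i >= -p} is extended by 0 to *)
(* the indices i < -p, and a finite string is identified with the infinite one *)
(* obtained by appending zeros.                                                *)
Definition digit_string := int -> int.

(* In the series, the n-th term is the one of index i = n - p. *)
Definition smr_represents (R : realType) (r : nat) (d : digit_string) (v : R)
    : Prop :=
  exists p : nat,
    [/\ forall i : int, - (r%:Z - 1) <= d i <= r%:Z - 1,
        forall i : int, i < - p%:Z -> d i = 0
      & [series (d (n%:Z - p%:Z))%:~R * (r%:R : R) ^ (- (n%:Z - p%:Z))]_n @ \oo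
          --> v].

(* X k j is the digit string chosen for the j-th component of x k.  The digits *)
(* required to be stable are those of index i <= D, including those to the     *)
(* left of the radix point (i <= 0).                                           *)
Definition digit_stability (R : realType) (r m : nat) (x : nat -> 'cV[R]_m)
    : Prop :=
  forall D : nat, (1 <= D)%N ->
  exists (khat : nat) (X : nat -> 'I_m -> digit_string),
    (forall (k : nat) (j : 'I_m), smr_represents r (X k j) (x k j 0)) /\
    (forall k : nat, (khat < k)%N ->
     forall i : int, i <= D%:Z -> forall j : 'I_m, X k j i = X khat j i).

(* Main.v *)
Require Import Defs.
From mathcomp Require Import all_boot all_order all_algebra.
From mathcomp Require Import all_classical all_reals all_analysis.
From mathcomp Require Import zify lra.
Import Order.TTheory GRing.Theory Num.Theory numFieldNormedType.Exports.
Local Open Scope ring_scope.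

(** The map is a contraction for the infinity norm, so the iterates eventually
    stay within any prescribed distance of one fixed iterate
    ([contraction_iter_dist]); the limit itself never has to be named.

    What makes this yield stable digits is the redundancy of the number system.
    Take an iterate K beyond which every iterate stays within r^(-D) / 2 of the
    K-th one, and in each component round x_K r^D to an integer N.  Every later
    value v then satisfies |v - N r^(-D)| < r^(-D), whichever side of N r^(-D)
    it lies on, so that it can be written as the digits of N r^(-D), followed
    from index D + 1 on by the digits, all of the sign of v - N r^(-D), of that
    difference ([smr_represents_prefix]).  The digits of index at most D thus
    depend on N alone.  With the standard digits this would fail: values
    oscillating around N r^(-D) would have different leading digits.

    Both pieces use one explicit expansion, [trunc_digit]: the ordinary radix-r
    expansion of |t| with each digit multiplied by the sign of t. *)

(** * The operator norm and contractions *)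

Lemma entry_le_norm {R : realType} {m : nat} (w : 'cV[R]_m) (j : 'I_m) :
  `|w j 0| <= `|w|.
Proof.
rewrite [X in _ <= X]mx_normrE.
exact: (le_bigmax _ (fun ij => `|w ij.1 ij.2|) (j, 0)).
Qed.

(** This crude bound makes the set defining [opnorm_oo] bounded above, without
    which its [sup] would carry no information. *)
Lemma opnorm_oo_bounded (R : realType) (m : nat) (B : 'M[R]_m) (v : 'cV[R]_m) :
  `|B *m v| <= (\sum_i \sum_j `|B i j|) * `|v|.
Proof.
rewrite [X in X <= _]mx_normrE; apply: bigmax_le => [|[i j] _ /=].
  by rewrite mulr_ge0 // sumr_ge0 // => i _; apply: sumr_ge0.
rewrite ord1 mxE (le_trans (ler_norm_sum _ _ _)) //.
apply: (@le_trans _ _ ((\sum_k `|B i k|) * `|v|)).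
  by rewrite mulr_suml; apply: ler_sum => k _; rewrite normrM ler_wpM2l // entry_le_norm.
apply: ler_wpM2r => //; rewrite [leRHS](bigD1 i) //= lerDl.
by apply: sumr_ge0 => k _; apply: sumr_ge0.
Qed.

Lemma opnorm_oo_le (R : realType) (m : nat) (B : 'M[R]_m) (v : 'cV[R]_m) :
  `|B *m v| <= opnorm_oo B * `|v|.
Proof.
have [->|v0] := eqVneq v 0; first by rewrite mulmx0 normr0 mulr0.
have nv : 0 < `|v| by rewrite normr_gt0.
rewrite -ler_pdivrMr // mulrC.
have -> : `|v|^-1 * `|B *m v| = `|B *m (`|v|^-1 *: v)|.
  by rewrite -scalemxAr normrZ ger0_norm // invr_ge0.
apply: ub_le_sup; last first.
  by exists (`|v|^-1 *: v) => //=; rewrite normrZ normfV normr_id mulVf // gt_eqF.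
exists (\sum_i \sum_j `|B i j|) => _ [w /= w1 <-].
apply: le_trans (opnorm_oo_bounded _ _ _ _) _.
by rewrite ler_piMr // sumr_ge0 // => i _; apply: sumr_ge0.
Qed.

(** By induction all iterates stay within C = |f x0 - x0| / (1 - q) of x0,
    because q C + (1 - q) C = C; then K applications of f shrink the distance
    between the (k - K)-th iterate and x0 by q^K. *)
Lemma contraction_iter_dist {R : realType} {V : normedModType R} (f : V -> V)
    (q : R) (x0 : V) : 0 <= q -> q < 1 ->
  (forall x y, `|f x - f y| <= q * `|x - y|) ->
  forall K k, (K <= k)%N ->
    `|iter k f x0 - iter K f x0| <= q ^+ K * (`|f x0 - x0| / (1 - q)).
Proof.
move=> q_ge0 q_lt1 fq; set C := _ / _.
have C1 : `|f x0 - x0| = (1 - q) * C by rewrite mulrC divfK // subr_eq0 gt_eqF.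
have from0 n : `|iter n f x0 - x0| <= C.
  elim: n => [|n IHn] /=; first by rewrite subrr normr0 divr_ge0 // subr_ge0 ltW.
  apply: le_trans (ler_distD (f x0) _ _) _.
  have := le_trans (fq (iter n f x0) x0) (ler_wpM2l q_ge0 IHn); lra.
elim=> [|K IHK] [|k] //= Kk; rewrite ?mul1r.
- exact: (from0 0%N).
- exact: (from0 k.+1).
- by rewrite exprS -mulrA (le_trans (fq _ _)) // ler_wpM2l // IHK.
Qed.

(** * Truncation toward zero *)

(** Rounding toward zero rather than down makes the integer part an odd
    function, so that the digits extracted from it below form a symmetric
    set. *)
Definition trunc0 {R : realType} (x : R) : int :=
  if 0 <= x then Num.floor x else Num.ceil x.

Lemma trunc0N {R : realType} (x : R) : trunc0 (- x) = - trunc0 x.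
Proof.
rewrite /trunc0 oppr_ge0 !ceilNfloor opprK.
by case: (ltgtP x 0) => [_|_|->]; rewrite ?oppr0 ?floor0 ?opprK.
Qed.

Lemma trunc0_ge0 {R : realType} (x : R) :
  0 <= x -> trunc0 x = Num.floor x.
Proof. by rewrite /trunc0 => ->. Qed.

Lemma sym_ge0_ind {R : realType} (P : R -> Prop) :
  (forall x, P x -> P (- x)) -> (forall x, 0 <= x -> P x) -> forall x, P x.
Proof.
move=> PN Pge0 x; have [/Pge0 //|x_lt0] := leP 0 x.
by rewrite -(opprK x); apply/PN/Pge0; rewrite oppr_ge0 ltW.
Qed.

Lemma trunc0_dist {R : realType} (x : R) : `|x - (trunc0 x)%:~R| < 1.
Proof.
move: x; apply: sym_ge0_ind => [x|x x_ge0].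
  by rewrite trunc0N rmorphN -opprD normrN.
rewrite trunc0_ge0 //; have /andP[] := floor_itv x.
by rewrite intrD ltr_norml => *; lra.
Qed.

Lemma trunc0_int {R : realType} (n : int) : trunc0 (n%:~R : R) = n.
Proof.
rewrite /trunc0; case: ifP => _; first exact: intrKfloor.
by rewrite ceilNfloor -rmorphN /= intrKfloor opprK.
Qed.

Lemma trunc0_small {R : realType} (x : R) : `|x| < 1 -> trunc0 x = 0.
Proof.
move: x; apply: sym_ge0_ind => [x|x x_ge0]; first by rewrite normrN trunc0N => IH /IH ->.
rewrite ger0_norm // trunc0_ge0 // => x_lt1.
by apply: floor_def; rewrite x_ge0.
Qed.

(** For x >= 0 this is the usual bound on a digit, the floor of r x being at
    least r times the floor of x and less than that plus r; oddness gives the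
    other sign. *)
Lemma trunc0_carry {R : realType} (r : nat) (x : R) : (0 < r)%N ->
  `|trunc0 (r%:R * x) - r%:Z * trunc0 x| <= r%:Z - 1.
Proof.
move=> r_gt0; move: x; apply: sym_ge0_ind => [x|x x_ge0].
  by rewrite mulrN !trunc0N mulrN -opprD normrN.
rewrite !trunc0_ge0 ?mulr_ge0 //.
have r0 : 0 < r%:R :> R by rewrite ltr0n.
have /andP[le_x lt_x] := floor_itv x.
have lo : r%:Z * Num.floor x <= Num.floor (r%:R * x).
  by rewrite floor_ge_int intrM ler_pM2l.
have hi : Num.floor (r%:R * x) < r%:Z * (Num.floor x + 1).
  by rewrite floor_lt_int intrM ltr_pM2l.
have close (a c s : int) : c <= a -> a < c + s -> `|a - c| <= s - 1 by lia.
by apply: close; rewrite // -[X in _ + X]mulr1 -mulrDr.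
Qed.

(** * Signed digits obtained by truncation *)

(** t r^i truncated is the integer formed by the digits of index at most i;
    subtracting r times its predecessor leaves the digit of index i. *)
Definition trunc_digit {R : realType} (r : nat) (t : R) : digit_string :=
  fun i => trunc0 (t * r%:R ^ i) - r%:Z * trunc0 (t * r%:R ^ (i - 1)).

Section TruncDigit.
Context {R : realType} {r : nat} (hr : (2 <= r)%N).
Implicit Types (t : R) (i : int).

Let r_gt0 : 0 < r%:R :> R.
Proof. by rewrite ltr0n; lia. Qed.
Let r_neq0 : r%:R != 0 :> R.
Proof. by rewrite gt_eqF. Qed.
Let r_ge1 : 1 <= r%:R :> R.
Proof. by rewrite ler1n; lia. Qed.

Lemma trunc_digit_bound t i : `|trunc_digit r t i| <= r%:Z - 1.
Proof.
rewrite /trunc_digit.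
have -> : t * r%:R ^ i = r%:R * (t * r%:R ^ (i - 1)).
  by rewrite -{1}(subrK 1 i) addrC expfzDr // expr1z mulrCA.
by apply: trunc0_carry; lia.
Qed.

(** The truncations at indices at most D are all 0.  With t small this bounds
    the support of an expansion on the left. *)
Lemma trunc_digit_lead t i D :
  `|t| * r%:R ^ D < 1 -> i <= D -> trunc_digit r t i = 0.
Proof.
move=> t_lt iD; have small j : j <= D -> trunc0 (t * r%:R ^ j) = 0.
  move=> jD; apply: trunc0_small; rewrite normrM (ger0_norm (exprz_ge0 _ _)) ?ltW //.
  by apply: le_lt_trans t_lt; rewrite ler_wpM2l // ler_weXz2l.
by rewrite /trunc_digit !small ?mulr0 ?subrr //; lia.
Qed.

(** From index D on the scaled value is already an integer, so truncation no
    longer discards anything and consecutive truncations differ by exactly the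
    factor r. *)
Lemma trunc_digit_trail (N D i : int) :
  D < i -> trunc_digit r (N%:~R * r%:R ^ (- D) : R) i = 0.
Proof.
move=> Di; have shift (j : int) : D <= j ->
    trunc0 (N%:~R * r%:R ^ (- D) * r%:R ^ j : R) = N * r%:Z ^+ absz (j - D).
  move=> Dj; rewrite -mulrA -expfzDr //.
  rewrite -[RHS](@trunc0_int R) intrM rmorphXn /=; congr (trunc0 (_ * _)).
  have -> : - D + j = (absz (j - D))%:Z by lia.
  by [].
rewrite /trunc_digit !shift; try lia.
have -> : absz (i - D)%R = (absz (i - 1 - D)%R).+1 by lia.
by rewrite exprS mulrCA subrr.
Qed.

(** The n-th partial sum telescopes to t truncated after the digit of index
    n - 1 - p, which is within r^(-(n - 1 - p)) of t.  The hypothesis says that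
    nothing is cut off on the left: the truncation at index -1 - p, where the
    telescoping sum starts, is 0. *)
Lemma trunc_digit_series t (p : nat) : `|t| * r%:R ^ (- 1 - p%:Z) < 1 ->
  ([series (trunc_digit r t (n%:Z - p%:Z))%:~R
           * (r%:R : R) ^ (- (n%:Z - p%:Z))]_n @ \oo --> t)%classic.
Proof.
move=> t_lt.
(* t cut after the n digits of index -p, ..., n - 1 - p *)
pose g (n : nat) : R :=
  (trunc0 (t * r%:R ^ (n%:Z - 1 - p%:Z)))%:~R * r%:R ^ (- (n%:Z - 1 - p%:Z)).
have partial n : [series (trunc_digit r t (n%:Z - p%:Z))%:~R
           * (r%:R : R) ^ (- (n%:Z - p%:Z))]_n n = g n.
  rewrite /series /=; transitivity (g n - g 0%N); last first.
    by rewrite {2}/g trunc0_small ?mul0r ?subr0 // normrM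
      (ger0_norm (exprz_ge0 _ _)) ?ltW // sub0r.
  apply: telescope_sumr_eq => // k _.
  rewrite /g /trunc_digit.
  have -> : k.+1%:Z - 1 - p%:Z = k%:Z - p%:Z by lia.
  have -> : k%:Z - p%:Z - 1 = k%:Z - 1 - p%:Z by lia.
  rewrite rmorphB /= mulrBl intrM; congr (_ - _).
  have -> : - (k%:Z - 1 - p%:Z) = 1 + (- (k%:Z - p%:Z)) by lia.
  by rewrite (expfzDr 1 (- (k%:Z - p%:Z))) // expr1z mulrA [_%:~R * r%:R]mulrC.
have err n : `|g n - t| <= geometric (r%:R ^ (1 + p%:Z)) (r%:R^-1) n.
  rewrite /geometric /=; set e := n%:Z - 1 - p%:Z.
  have -> : r%:R ^ (1 + p%:Z) * r%:R^-1 ^+ n = r%:R ^ (- e) :> R.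
    rewrite -[_ ^+ n]/(_ ^ n%:Z) exprz_inv -expfzDr //; congr (_ ^ _); rewrite /e; lia.
  have e_gt0 : 0 < r%:R ^ (- e) :> R by rewrite exprz_gt0.
  have -> : g n - t = ((trunc0 (t * r%:R ^ e))%:~R - t * r%:R ^ e) * r%:R ^ (- e).
    by rewrite mulrBl -mulrA -expfzDr // subrr expr0z mulr1.
  rewrite normrM (gtr0_norm e_gt0) ler_piMl ?(ltW e_gt0) //.
  by rewrite distrC ltW // trunc0_dist.
rewrite (_ : [series _]_n = g); last by apply/funext.
have geo0 : (geometric (r%:R ^ (1 + p%:Z)) (r%:R^-1 : R) @ \oo --> 0)%classic.
  by apply: cvg_geometric; rewrite gtr0_norm ?invr_gt0 // invf_lt1 // ltr1n; lia.
apply/subr_cvg0/norm_cvg0P.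
apply: (squeeze_cvgr _ (cvg_cst 0) geo0).
by near=> n; rewrite normr_ge0 err.
Unshelve. all: by end_near. Qed.

Lemma radix_bound t : exists p0 : nat, forall p : nat, (p0 <= p)%N ->
  `|t| * r%:R ^ (- p%:Z) < 1.
Proof.
exists (Num.bound t) => p le_p.
rewrite -exprz_inv -[_ ^ _]/(_ ^+ _) exprVn ltr_pdivrMr ?exprn_gt0 // mul1r.
apply: (lt_le_trans (unstable.ltr_norm_bound t)).
by rewrite -natrX ler_nat (leq_trans le_p) // ltnW // ltn_expl.
Qed.

(** * Representations with a prescribed prefix *)

(** The two expansions have disjoint supports: the digits of N r^(-D) stop at
    index D and those of the remainder, smaller than r^(-D) in absolute value,
    start after D.  Hence their digitwise sum stays within the digit set, even
    when the two parts have opposite signs. *)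
Lemma smr_represents_prefix (N D : int) t :
  `|t - N%:~R * r%:R ^ (- D)| * r%:R ^ D < 1 ->
  smr_represents r (fun i => trunc_digit r (N%:~R * r%:R ^ (- D) : R) i
                           + trunc_digit r (t - N%:~R * r%:R ^ (- D)) i) t.
Proof.
pose h : R := N%:~R * r%:R ^ (- D); rewrite -/h; set l := t - h => l_lt.
have [ph hph] := radix_bound h; have [pl hpl] := radix_bound l.
pose p := maxn ph pl; exists p; split.
- move=> i; rewrite -ler_norml; have [iD|Di] := leP i D.
    by rewrite [X in _ + X](trunc_digit_lead _ _ _ l_lt iD) // addr0 trunc_digit_bound.
  by rewrite trunc_digit_trail // add0r trunc_digit_bound.
- have hp (x : R) px : (px <= p)%N -> (forall q : nat, (px <= q)%N -> `|x| * r%:R ^ (- q%:Z) < 1) ->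
    forall i, i < - p%:Z -> trunc_digit r x i = 0.
    move=> lep hx i ip; apply: (trunc_digit_lead _ _ (- p%:Z)); [exact: hx|exact: ltW].
  by move=> i ip; rewrite (hp _ _ (leq_maxl _ _) hph) ?(hp _ _ (leq_maxr _ _) hpl).
- have cv (x : R) px : (px <= p)%N -> (forall q : nat, (px <= q)%N -> `|x| * r%:R ^ (- q%:Z) < 1) ->
    ([series (trunc_digit r x (n%:Z - p%:Z))%:~R
           * (r%:R : R) ^ (- (n%:Z - p%:Z))]_n @ \oo --> x)%classic.
    move=> lep hx; apply: trunc_digit_series.
    have -> : - 1 - p%:Z = - p.+1%:Z by lia.
    by apply: hx; exact: leqW.
  have := cvgD (cv _ _ (leq_maxl _ _) hph) (cv _ _ (leq_maxr _ _) hpl).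
  have -> : h + l = t by rewrite /l addrC subrK.
  (* the argument skipped is the filter instance required by [cvgD] *)
  move=> /(_ _) cvhl; apply: cvg_trans cvhl; apply: near_eq_cvg; apply: nearW => n.
  rewrite !fctE /series /= -big_split /=.
  by apply: eq_bigr => k _; rewrite -mulrDl -intrD.
Qed.

(** The case D = 0 of the previous lemma, with t truncated as N. *)
Lemma smr_represents_exists t : exists d, smr_represents r d t.
Proof.
exists (fun i => trunc_digit r (((trunc0 t)%:~R : R) * r%:R ^ (- 0)) i
               + trunc_digit r (t - (trunc0 t)%:~R * r%:R ^ (- 0)) i).
by apply: smr_represents_prefix; rewrite oppr0 expr0z !mulr1 trunc0_dist.
Qed.

(** The redundancy argument: if the tail of the sequence stays close to a term
    x_K, rounding that term at position D yields a prefix that serves the whole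
    tail. *)
Lemma digit_stability_near m (x : nat -> 'cV[R]_m) :
  (forall e : R, 0 < e -> exists K : nat,
    forall k, (K <= k)%N -> `|x k - x K| < e) ->
  digit_stability r x.
Proof.
move=> x_near D _.
have rD_gt0 : 0 < r%:R ^ D%:Z :> R by rewrite exprz_gt0.
(* Half a unit at position D for the distance to x_K; rounding x_K to N costs
   at most another half. *)
have [|K hK] := x_near (2^-1 / r%:R ^ D%:Z).
  by rewrite divr_gt0.
pose N j := Num.floor (x K j 0 * r%:R ^ D%:Z + 2^-1).
have hN k (j : 'I_m) : (K <= k)%N ->
    `|x k j 0 - (N j)%:~R * r%:R ^ (- D%:Z)| * r%:R ^ D%:Z < 1.
  move=> Kk; rewrite -[X in _ * X](gtr0_norm rD_gt0) -normrM mulrBl.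
  rewrite -mulrA -expfzDr // addNr expr0z mulr1.
  have dist : `|x k j 0 - x K j 0| * r%:R ^ D%:Z < 2^-1.
    rewrite -ltr_pdivlMr //; apply: le_lt_trans (hK k Kk).
    by have := entry_le_norm (x k - x K) j; rewrite !mxE.
  rewrite -{1}(subrK (x K j 0) (x k j 0)) mulrDl -addrA.
  apply: le_lt_trans (ler_normD _ _) _.
  rewrite normrM (gtr0_norm rD_gt0).
  have /andP[] := floor_itv (x K j 0 * r%:R ^ D%:Z + 2^-1).
  rewrite -/(N j) intrD => lo hi.
  suff : `|x K j 0 * r%:R ^ D%:Z - (N j)%:~R| <= 2^-1 by lra.
  by rewrite ler_norml; lra.
(* Before index K any representation will do. *)
pose X k j : digit_string :=
  if (K <= k)%N then
    fun i => trunc_digit r ((N j)%:~R * r%:R ^ (- D%:Z) : R) i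
             + trunc_digit r (x k j 0 - (N j)%:~R * r%:R ^ (- D%:Z)) i
  else sval (cid (smr_represents_exists (x k j 0))).
exists K, X; split=> [k j|k Kk i iD j].
  rewrite /X; case: ifPn => [Kk|_]; first exact/smr_represents_prefix/hN.
  by case: cid.
rewrite /X leqnn (ltnW Kk).
by rewrite !(trunc_digit_lead _ _ _ (hN _ _ _) iD) // ltnW.
Qed.
End TruncDigit.

(** * Digit stability of the stationary method *)

Theorem mainTheorem4 (R : realType) (r m : nat) (hr : (2 <= r)%N)
    (A M : 'M[R]_m) (b x0 : 'cV[R]_m) (hM : M \in unitmx)
    (hT : opnorm_oo (1%:M - invmx M *m A) < 1) :
  digit_stability r (stationary_iterate A M b x0).
Proof.
(* The maximum with 0 spares a proof that the operator norm is nonnegative. *)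
set B := 1%:M - _ in hT; pose q := Num.max 0 (opnorm_oo B).
have q_ge0 : 0 <= q by rewrite le_max lexx.
have q_lt1 : q < 1 by rewrite gt_max ltr01.
have Tq x y : `|stationary_map A M b x - stationary_map A M b y| <= q * `|x - y|.
  rewrite /stationary_map -/B opprD addrACA subrr addr0 -mulmxBr.
  apply: le_trans (opnorm_oo_le _ _ _ _) _.
  by rewrite ler_wpM2r // le_max lexx orbT.
have dist := contraction_iter_dist (stationary_map A M b) q x0 q_ge0 q_lt1 Tq.
apply: digit_stability_near => // e e_gt0.
set C := _ / _ in dist.
have small : \forall K \near \oo%classic, q ^+ K * C < e.
  have : (geometric C q @ \oo --> 0)%classic.
    by apply: cvg_geometric; rewrite ger0_norm.
  move=> /cvgr_lt /(_ e e_gt0); apply: filterS => n.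
  by rewrite /geometric /= mulrC.
have [K _ hK] := small; exists K => k Kk.
exact: le_lt_trans (dist K k Kk) (hK K (leqnn K)).
Qed.
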